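(* For every $r\ge3$ there exists a family $\mathcal{D}^r$ of $r$-graphs with $\mathrm{proj}\,\Omega(\mathcal{D}^r)=[0,1]$ and $g(\mathcal{D}^r,(r-1)!/r^{r-2})=r!/r^r$, but there exists an absolute constant $\delta_0>0$ such that $g(\mathcal{D}^r,(r-1)!/r^{r-2}+\epsilon)<r!/r^r-\delta_0$ for all $0<\epsilon\le1-(r-1)!/r^{r-2}$.
   Context: An $r$-graph $\mathcal{H}$ is a finite vertex set $V(\mathcal{H})$ together with a set of $r$-element subsets (edges); $v(\mathcal{H})=|V(\mathcal{H})|$. The shadow is $\partial\mathcal{H}=\{A\in\binom{V(\mathcal{H})}{r-1}: A\subset B\text{ for some }B\in\mathcal{H}\}$. $\mathcal{H}$ is $\mathcal{F}$-free if it contains no member of $\mathcal{F}$ as a (not necessarily induced) subgraph. Densities: $d(\mathcal{H})=|\mathcal{H}|/\binom{v(\mathcal{H})}{r}$, $d(\partial\mathcal{H})=|\partial\mathcal{H}|/\binom{v(\mathcal{H})}{r-1}$. A sequence $(\mathcal{H}_k)$ is good if $v(\mathcal{H}_k)\to\infty$ and both density limits exist; it realizes $(x,y)$ if $\lim d(\partial\mathcal{H}_k)=x$ and $\lim d(\mathcal{H}_k)=y$. $\Omega(\mathcal{F})$ is the set of points of $[0,1]^2$ realized by good sequences of $\mathcal{F}$-free $r$-graphs (a closed set); $\mathrm{proj}\,\Omega(\mathcal{F})=\{x:\exists y,\ (x,y)\in\Omega(\mathcal{F})\}$ and $g(\mathcal{F},x)=\max\{y:(x,y)\in\Omega(\mathcal{F})\}$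 for $x\in\mathrm{proj}\,\Omega(\mathcal{F})$. *)

(* Defs.v *)
From HB Require Import structures.
From mathcomp Require Import all_boot all_order all_algebra.
From mathcomp Require Import all_classical all_reals all_analysis.

Set Implicit Arguments.
Unset Strict Implicit.
Unset Printing Implicit Defensive.
Import Order.TTheory GRing.Theory Num.Theory.
Import numFieldNormedType.Exports.
Local Open Scope classical_set_scope.
Local Open Scope ring_scope.

(* Vertices are labelled 0, ..., n-1. A record over arbitrary [finType]s would
   be too large a type for [set]; everything below is invariant under
   isomorphism, so nothing is lost. *)
Record hypergraph (r : nat) := Hypergraph {
  order_of : nat;
  edges : {set {set 'I_order_of}};
  edges_card : forall e, e \in edges -> #|e| = r }.

Definition shadow r (H : hypergraph r) : {set {set 'I_(order_of H)}} :=
  [set A : {set 'I_(order_of H)} |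
    (#|A| == r.-1) && [exists B in edges H, A \subset B]].

Definition density (R : realType) r (H : hypergraph r) : R :=
  #|edges H|%:R / 'C(order_of H, r)%:R.

Definition shadow_density (R : realType) r (H : hypergraph r) : R :=
  #|shadow H|%:R / 'C(order_of H, r.-1)%:R.

Definition contains r (H F : hypergraph r) : Prop :=
  exists2 f : 'I_(order_of F) -> 'I_(order_of H), injective f &
    forall e, e \in edges F -> f @: e \in edges H.

(* The family may be infinite. *)
Definition is_free r (D : set (hypergraph r)) (H : hypergraph r) : Prop :=
  forall F, D F -> ~ contains H F.

Definition good (R : realType) r (H : nat -> hypergraph r) : Prop :=
  [/\ (fun k => order_of (H k)) @ \oo --> \oo,
      cvgn (fun k => shadow_density R (H k)) &
      cvgn (fun k => density R (H k))].

Definition realizes (R : realType) r (H : nat -> hypergraph r) (x y : R) : Prop :=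
  (fun k => shadow_density R (H k)) @ \oo --> x /\
  (fun k => density R (H k)) @ \oo --> y.

Definition Omega (R : realType) r (D : set (hypergraph r)) : set (R * R) :=
  [set p | [/\ 0 <= p.1 <= 1, 0 <= p.2 <= 1 &
     exists H : nat -> hypergraph r,
       [/\ good R H, forall k, is_free D (H k) & realizes H p.1 p.2]]].

Definition projOmega (R : realType) r (D : set (hypergraph r)) : set R :=
  [set x | exists y, Omega D (x, y)].

Definition is_max (R : realType) (A : set R) (m : R) : Prop :=
  A m /\ ubound A m.

(* The maximum of the fibre of [Omega D] over [x]. The default value [0] is
   only taken outside [projOmega D]: see [gP]. *)
Definition g (R : realType) r (D : set (hypergraph r)) (x : R) : R :=
  xget 0 (is_max [set y | Omega D (x, y)]).

Lemma gP (R : realType) r (D : set (hypergraph r)) (x : R) :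
  projOmega D x -> is_max [set y | Omega D (x, y)] (g D x).
Proof.
move=> [y0 Oy0]; apply: xgetPex.
set S := [set y | Omega D (x, y)].
have S0 : S !=set0 by exists y0.
have Sub : has_ubound S by exists 1 => y [_ /andP[]].
have Ssup : has_sup S by split.
exists (sup S); split; last by move=> y Sy; exact: ub_le_sup.
have /choice[H HP] : forall j : nat, exists G : hypergraph r,
    [/\ is_free D G, (j <= order_of G)%N,
        `|x - shadow_density R G| < j.+1%:R^-1 &
        `|sup S - density R G| < j.+1%:R^-1].
  move=> j.
  have e0 : 0 < (j.+1%:R^-1 : R) / 2 by rewrite divr_gt0// invr_gt0.
  have [y Sy yS] := sup_adherent e0 Ssup.
  have yle : y <= sup S by exact: ub_le_sup.
  case: Sy => _ _ [K [[Kv _ _] Kfree [/= Kx Ky]]].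
  move/cvgnyPge : Kv => /(_ j) Kv.
  move/cvgrPdist_lt : Kx => /(_ _ e0) Kx.
  move/cvgrPdist_lt : Ky => /(_ _ e0) Ky.
  have [k [[kv kx] ky]] := filter_ex (filterI (filterI Kv Kx) Ky).
  exists (K k); split=> //.
    by rewrite (lt_trans kx)// ltr_pdivrMr// ltr_pMr ?invr_gt0// ltr1n.
  rewrite -(subrKA y) (le_lt_trans (ler_normD _ _))// [ltRHS]splitr ltrD//.
  by rewrite ger0_norm ?subr_ge0// ltrBlDl -ltrBlDr.
have lim (u : nat -> R) l : (forall j, `|l - u j| < j.+1%:R^-1) ->
    u @ \oo --> l.
  move=> ul; apply/cvgrPdist_lt => e e0; near=> n.
  rewrite (lt_trans (ul n))//.
  near: n; exact: (near_infty_natSinv_lt (PosNum e0)).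
have Hx : (fun k => shadow_density R (H k)) @ \oo --> x.
  by apply: lim => j; have [] := HP j.
have Hy : (fun k => density R (H k)) @ \oo --> sup S.
  by apply: lim => j; have [] := HP j.
split => /=; first by case: Oy0.
  apply/andP; split.
    by apply: (le_trans _ (ub_le_sup Sub Oy0)); case: Oy0 => _ /andP[].
  by apply: ge_sup => // y [_ /andP[]].
exists H; split=> //; last by move=> k; have [] := HP k.
split; [|by apply/cvg_ex; exists x|by apply/cvg_ex; exists (sup S)].
apply/cvgnyPge => A; near=> n.
have [_ nH _ _] := HP n; apply: leq_trans nH.
by near: n; exact: nbhs_infty_ge.
Unshelve. all: by end_near. Qed.

(* Main.v *)
(* The properties "r-partite" and "any two distinct edges share fewer than r-1
   vertices" (partial Steiner system) pass to subgraphs. Forbidding every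
   r-graph having neither property therefore leaves exactly the r-graphs having
   one of them.
   With parts of sizes n_1, ..., n_r and n vertices in total, AM-GM and
   Maclaurin's inequality bound the number of edges by (n/r)^r and the shadow by
   r (n/r)^(r-1); the balanced complete r-partite r-graphs attain both bounds,
   which are asymptotically the densities r!/r^r and (r-1)!/r^(r-2).
   Beyond this shadow density only partial Steiner systems remain, and their edge
   density tends to 0. They still reach every shadow density in [0,1]: the
   r-subsets of F_3^k with sum zero form a partial Steiner system whose shadow
   contains almost all (r-1)-sets, and keeping a fraction x of the edges keeps
   the same fraction of the shadow. *)
Require Import Defs.
From mathcomp Require Import all_boot all_order all_algebra.
From mathcomp Require Import all_classical all_reals all_analysis.
From mathcomp Require Import lra ring zify.
Import Order.TTheory GRing.Theory Num.Theory.
Import numFieldNormedType.Exports.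
Local Open Scope ring_scope.

Set Implicit Arguments.
Unset Strict Implicit.
Unset Printing Implicit Defensive.

(** * Two properties inherited by subgraphs *)

(** This encodes r-partiteness: an edge has r vertices, so a colouring injective on it meets each of
    the r classes exactly once. *)
Definition colorable r (H : hypergraph r) : Prop :=
  exists c : 'I_(order_of H) -> 'I_r, forall e, e \in edges H -> {in e &, injective c}.

Definition partial_steiner r (H : hypergraph r) : Prop :=
  forall e f, e \in edges H -> f \in edges H -> (r.-1 <= #|e :&: f|)%N -> e = f.

Lemma colorable_contains r (H F : hypergraph r) :
  contains H F -> colorable H -> colorable F.
Proof.
move=> [f finj fE] [c cP]; exists (c \o f) => e eF x y xe ye /= cxy.
by apply/finj/(cP _ (fE e eF)) => //; exact: imset_f.
Qed.

Lemma partial_steiner_contains r (H F : hypergraph r) :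
  contains H F -> partial_steiner H -> partial_steiner F.
Proof.
move=> [f finj fE] HP e1 e2 e1F e2F le12.
apply: (imset_inj finj); apply: (HP _ _ (fE _ e1F) (fE _ e2F)).
by rewrite -imsetI ?card_imset// => x y _ _; exact: finj.
Qed.

Lemma contains_refl r (H : hypergraph r) : contains H H.
Proof. by exists id => // e; rewrite imset_id. Qed.

(** An r-graph outside [C] is itself forbidden and contains itself; one inside [C] has, by heredity,
    only subgraphs in [C]. *)
Lemma is_free_setC r (C : set (hypergraph r)) :
  (forall H F, contains H F -> C H -> C F) ->
  forall H, is_free (~` C)%classic H <-> C H.
Proof.
move=> Cmono H; split=> [Hfree|CH F nCF HF]; last exact: nCF (Cmono _ _ HF CH).
by apply: contrapT => nCH; exact: Hfree nCH (contains_refl H).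
Qed.

(** * Counting edges and shadow sets *)

(** A set is determined by its traces on the fibres of [c]. For a member of [S] the trace is a
    singleton over each colour in [J] and empty over the others, so the traces inject [S] into a
    product. *)
Lemma card_transversal (T I : finType) (c : T -> I) (J : {set I})
    (S : {set {set T}}) :
  (forall A, A \in S -> {in A &, injective c} /\ c @: A = J) ->
  (#|S| <= \prod_(i in J) #|[set x | c x == i]|)%N.
Proof.
move=> SP.
pose part A : {ffun I -> {set T}} := [ffun i => A :&: [set x | c x == i]].
pose F i : {set {set T}} :=
  if i \in J then [set [set x] | x in [set x | c x == i]] else [set finset.set0].
have part_inj : injective part.
  move=> A B /ffunP AB; apply/setP => x; move: (AB (c x)) => /setP/(_ x).
  by rewrite !ffunE !inE eqxx !andbT.
have partF : part @: S \subset family (fun i => mem (F i)).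
  apply/fintype.subsetP => _ /imsetP[A AS ->]; apply/familyP => i; rewrite ffunE.
  suff: A :&: [set x | c x == i] \in F i by []; rewrite /F.
  have [cinj cA] := SP A AS; case: ifPn => iJ.
    move: (iJ); rewrite -cA => /imsetP[x xA ix].
    apply/imsetP; exists x; rewrite ?inE ?ix//.
    apply/setP => y; rewrite !inE; apply/andP/eqP => [[yA /eqP cyx]|->//].
    exact: cinj.
  apply/set1P/setP => x; rewrite !inE; apply/negbTE/negP.
  by move=> /andP[xA /eqP cxi]; case/negP: iJ; rewrite -cA -cxi imset_f.
rewrite -(card_imset _ part_inj).
apply: leq_trans (subset_leq_card partF) _.
rewrite card_family foldrE big_image /= [leqRHS]big_mkcond /=.
apply: leq_prod => i _; rewrite /F; case: ifP => _; last by rewrite cards1.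
exact: leq_imset_card.
Qed.

Lemma card_edges_colorable r (H : hypergraph r)
    (c : 'I_(order_of H) -> 'I_r) :
  (forall e, e \in edges H -> {in e &, injective c}) ->
  (#|edges H| <= \prod_i #|[set x | c x == i]|)%N.
Proof.
move=> cP; rewrite (eq_bigl (fun i => i \in (finset.setT : {set 'I_r}))); last first.
  by move=> i; rewrite finset.in_setT.
apply: card_transversal => e eH; split; first exact: cP.
apply/eqP; rewrite eqEcard finset.subsetT cardsT card_ord card_in_imset; last exact: cP.
by rewrite edges_card ?leqnn.
Qed.

(** A shadow set carries r-1 distinct colours, hence misses exactly one colour i. Each class [S i]
    is then bounded by [card_transversal]. *)
Lemma card_shadow_colorable r (H : hypergraph r)
    (c : 'I_(order_of H) -> 'I_r) : (0 < r)%N ->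
  (forall e, e \in edges H -> {in e &, injective c}) ->
  (#|shadow H| <= \sum_i \prod_(j | j != i) #|[set x | c x == j]|)%N.
Proof.
move=> r0 cP.
pose S i := [set A in shadow H | c @: A == [set~ i]].
have cA A : A \in shadow H -> {in A &, injective c}.
  rewrite inE => /andP[_ /existsP[e /andP[eH /fintype.subsetP Ae]]] x y xA yA.
  by apply: (cP e eH); exact: Ae.
have sub : shadow H \subset \bigcup_i S i.
  apply/fintype.subsetP => A AH.
  have /cards1P[i iA] : #|finset.setC (c @: A)| == 1%N.
    rewrite cardsCs finset.setCK card_ord card_in_imset; last exact: cA.
    by move: AH; rewrite inE => /andP[/eqP -> _]; rewrite -subn1 subKn.
  by apply/bigcupP; exists i => //; rewrite inE AH -iA finset.setCK eqxx.
apply: leq_trans (subset_leq_card sub) _.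
apply: (@leq_trans (\sum_i #|S i|)%N).
  elim/big_rec2: _ => [|i m B _ Bm]; first by rewrite cards0.
  by rewrite (leq_trans (leq_card_setU _ _))// leq_add2l.
apply: leq_sum => i _.
rewrite (eq_bigl (fun j => j \in [set~ i])); last by move=> j; rewrite !inE.
apply: card_transversal => A; rewrite inE => /andP[AH /eqP ->].
by split=> //; exact: cA.
Qed.

Lemma sum_card_fibers (T I : finType) (c : T -> I) :
  (\sum_i #|[set x | c x == i]| = #|T|)%N.
Proof.
rewrite -sum1_card (partition_big c predT)//=; apply: eq_bigr => i _.
by rewrite -sum1_card; apply: eq_bigl => x; rewrite inE.
Qed.

(** Each edge has exactly r subsets of size r-1, all of them in the shadow. *)
Lemma shadow_double_count r (H : hypergraph r) : (0 < r)%N ->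
  (\sum_(A in shadow H) #|[set e in edges H | A \subset e]| = r * #|edges H|)%N.
Proof.
move=> r0.
under eq_bigr do rewrite -sum1_card.
rewrite (exchange_big_dep (mem (edges H)))/=; last first.
  by move=> A e _; rewrite inE => /andP[].
rewrite (eq_bigr (fun=> r)); first by rewrite sum_nat_const mulnC.
move=> e eH; rewrite sum1_card.
have er : #|[set A : {set _} | A \subset e & #|A| == r.-1]| = r.
  by rewrite cards_draws edges_card// -{1}(prednK r0) binSn prednK.
rewrite -[RHS]er; apply: eq_card => A; rewrite -topredE /= !inE.
apply/andP/andP => [[/andP[-> _] /andP[_ ->]]//|[Ae Ar]].
by rewrite Ar eH Ae; split=> //; apply/existsP; exists e; rewrite eH.
Qed.

Lemma card_shadow_le r (H : hypergraph r) : (0 < r)%N ->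
  (#|shadow H| <= r * #|edges H|)%N.
Proof.
move=> r0; rewrite -shadow_double_count// -sum1_card; apply: leq_sum => A.
rewrite inE => /andP[_ /existsP[e /andP[eH Ae]]].
by rewrite card_gt0; apply/set0Pn; exists e; rewrite inE eH.
Qed.

(** Serves as a lower bound on the shadow, with d = 1 for partial Steiner systems and d = m for
    complete partite r-graphs. *)
Lemma card_edges_le_codegree r (H : hypergraph r) d : (0 < r)%N ->
  (forall A : {set _}, A \in shadow H ->
    #|[set e in edges H | A \subset e]| <= d)%N ->
  (r * #|edges H| <= d * #|shadow H|)%N.
Proof.
move=> r0 dP; rewrite -shadow_double_count// mulnC -sum_nat_const.
exact: leq_sum.
Qed.

Lemma card_edges_partial_steiner r (H : hypergraph r) : (0 < r)%N ->
  partial_steiner H -> (r * #|edges H| = #|shadow H|)%N.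
Proof.
move=> r0 HP; apply/eqP; rewrite eqn_leq card_shadow_le// andbT.
rewrite -[leqRHS]mul1n card_edges_le_codegree// => A; rewrite inE => /andP[/eqP Ar _].
apply/fintype.card_le1_eqP => e f; rewrite !inE => /andP[eH Ae] /andP[fH Af].
by apply: HP => //; rewrite -Ar subset_leq_card// finset.subsetI Ae Af.
Qed.

Lemma card_shadow_bin r (H : hypergraph r) :
  (#|shadow H| <= 'C(order_of H, r.-1))%N.
Proof.
rewrite -[X in 'C(X, _)]card_ord -card_draws subset_leq_card//.
by apply/fintype.subsetP => A; rewrite !inE => /andP[].
Qed.

Lemma card_edges_bin r (H : hypergraph r) :
  (#|edges H| <= 'C(order_of H, r))%N.
Proof.
rewrite -[X in 'C(X, _)]card_ord -card_draws subset_leq_card//.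
by apply/fintype.subsetP => e eH; rewrite inE edges_card.
Qed.

Lemma eq_card_draw (T : finType) (E : {set T}) t : (t <= #|E|)%N ->
  exists2 F : {set T}, F \subset E & #|F| = t.
Proof.
move=> tE; exists [set x in take t (enum E)].
  by apply/fintype.subsetP => x; rewrite inE => /mem_take; rewrite mem_enum.
rewrite cardsE (card_uniqP _) ?take_uniq ?enum_uniq//.
by rewrite size_take -cardE; case: ltngtP tE.
Qed.

(** * The balanced complete r-partite r-graphs *)

Section complete_partite.
Variables r m : nat.
Local Notation V := 'I_#|{: 'I_r * 'I_m}|.

(** A vertex stands for a pair (part, index in the part); [enum_val] and [enum_rank] translate
    between pairs and the ordinals that [hypergraph] requires. *)
Definition complete_partite_edges : {set {set V}} :=
  [set e : {set V} | (#|e| == r) && (#|[set (enum_val v).1 | v in e]| == r)].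

Lemma complete_partite_edges_card (e : {set V}) :
  e \in complete_partite_edges -> #|e| = r.
Proof. by rewrite inE => /andP[/eqP]. Qed.

Definition complete_partite : hypergraph r :=
  Hypergraph complete_partite_edges_card.

Lemma order_complete_partite : order_of complete_partite = (r * m)%N.
Proof. by rewrite /= card_prod !card_ord. Qed.

Definition part_of (v : V) : 'I_r := (enum_val v).1.

Lemma part_of_inj (e : {set V}) : e \in complete_partite_edges ->
  {in e &, injective part_of}.
Proof. by rewrite inE => /andP[/eqP er /eqP cr]; apply/imset_injP/eqP; rewrite er. Qed.

(** The graphs of the functions from parts to indices are distinct edges. The reverse inequality
    will come from AM-GM. *)
Lemma card_complete_partite_edges : (m ^ r <= #|complete_partite_edges|)%N.
Proof.
pose tr (f : {ffun 'I_r -> 'I_m}) : {set V} := [set enum_rank (i, f i) | i : 'I_r].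
have trE f i j : (enum_rank (i, j) \in tr f) = (j == f i).
  apply/imsetP/eqP => [[k _ /enum_rank_inj[-> ->]]//|->]; by exists i.
have tr_inj : injective tr.
  move=> f f' ff'; apply/ffunP => i; apply/eqP.
  by rewrite -trE -ff' trE.
rewrite -[X in (X ^ _)%N]card_ord -[X in (_ ^ X)%N]card_ord -card_ffun -cardsT.
rewrite -(card_imset _ tr_inj).
apply/subset_leq_card/fintype.subsetP => _ /imsetP[f _ ->]; rewrite inE.
rewrite card_imset ?card_ord ?eqxx/=; last by move=> i j /enum_rank_inj[].
suff -> : [set (enum_val v).1 | v in tr f] = finset.setT by rewrite cardsT card_ord.
apply/setP => i; rewrite finset.in_setT; apply/imsetP.
by exists (enum_rank (i, f i)); rewrite ?trE ?eqxx ?enum_rankK.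
Qed.

(** The set [A] misses a single part i, so an edge above [A] adds one of the m vertices of that
    part. *)
Lemma codegree_complete_partite (A : {set V}) : (0 < r)%N ->
  A \in shadow complete_partite ->
  (#|[set e in complete_partite_edges | A \subset e]| <= m)%N.
Proof.
move=> r0; rewrite inE => /andP[/eqP Ar /existsP[e0 /andP[e0E Ae0]]].
have partA : {in A &, injective part_of}.
  by move=> x y xA yA; apply: (part_of_inj e0E); exact: (fintype.subsetP Ae0).
have /cards1P[i iA] : #|finset.setC (part_of @: A)| == 1%N.
  rewrite cardsCs finset.setCK card_ord card_in_imset// Ar.
  by rewrite -subn1 subKn.
have mE : #|(finset.setT : {set 'I_m})| = m by rewrite cardsT card_ord.
rewrite -[leqRHS]mE.
apply: leq_trans (leq_imset_card (fun j : 'I_m => enum_rank (i, j) |: A) _).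
apply/subset_leq_card/fintype.subsetP => e; rewrite inE => /andP[eE Ae].
have er := complete_partite_edges_card eE.
have /imsetP[v ve iv] : i \in part_of @: e.
  suff -> : part_of @: e = finset.setT by [].
  apply/eqP; rewrite eqEcard finset.subsetT cardsT card_ord.
  by rewrite card_in_imset ?er ?leqnn//; exact: part_of_inj.
have vA : v \notin A.
  apply/negP => vA; have : i \in finset.setC (part_of @: A) by rewrite iA set11.
  by rewrite inE iv imset_f.
apply/imsetP; exists (enum_val v).2 => //.
have -> : (i, (enum_val v).2) = enum_val v.
  by rewrite iv /part_of -surjective_pairing.
rewrite enum_valK; apply/eqP; rewrite eq_sym eqEcard.
rewrite cardsU1 vA Ar er add1n prednK// leqnn andbT.
by rewrite finset.subUset finset.sub1set ve.
Qed.

End complete_partite.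

(** * Partial Steiner systems from zero-sum sets *)

Section zero_sum.
Variables (r : nat) (G : finZmodType).
Local Notation V := 'I_#|G|.

Definition zero_sum_edges : {set {set V}} :=
  [set e : {set V} | (#|e| == r) && (\sum_(v in e) (enum_val v : G) == 0)].

Lemma zero_sum_edges_card (F : {set {set V}}) : F \subset zero_sum_edges ->
  forall e, e \in F -> #|e| = r.
Proof. by move=> /fintype.subsetP FE e /FE; rewrite inE => /andP[/eqP]. Qed.

(** Subfamilies [F] are allowed so that the shadow can be thinned to any prescribed density. *)
Definition zero_sum (F : {set {set V}}) (FE : F \subset zero_sum_edges) : hypergraph r :=
  Hypergraph (zero_sum_edges_card FE).

(** Distinct edges sharing r-1 vertices would differ by one vertex on each side. Both sums vanish
    and the common part cancels, which forces these two vertices to be equal. *)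
Lemma zero_sum_partial_steiner (F : {set {set V}}) (FE : F \subset zero_sum_edges) :
  (0 < r)%N -> partial_steiner (zero_sum FE).
Proof.
move=> r0 e f /= eF fF ef; apply/eqP; apply: contraT => neq.
have [er fr] := (zero_sum_edges_card FE eF, zero_sum_edges_card FE fF).
have card_diff (a b : {set V}) : #|a| = r -> #|b| = r -> a != b ->
    (r.-1 <= #|a :&: b|)%N -> #|a :\: b| == 1%N.
  move=> ar br ab le; have := cardsID b a; rewrite ar.
  have : (#|a :\: b| != 0)%N.
    rewrite cards_eq0 finset.setD_eq0; apply: contra ab => ab.
    by rewrite eqEcard ab ar br leqnn.
  by move: le r0; lia.
have /cards1P[v ev] := card_diff e f er fr neq ef.
have /cards1P[w fw] : #|f :\: e| == 1%N.
  by apply: card_diff; rewrite // 1?eq_sym// finset.setIC.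
have vw : v = w.
  move: (fintype.subsetP FE _ eF) (fintype.subsetP FE _ fF); rewrite !inE.
  move=> /andP[_ /eqP] + /andP[_ /eqP].
  rewrite (big_setID f) (big_setID (A := f) e) /= ev fw !big_set1.
  rewrite (finset.setIC f e) => sv sw.
  exact/enum_val_inj/(addrI _ (etrans sv (esym sw))).
have : v \in e :\: f by rewrite ev set11.
have : v \in f :\: e by rewrite fw vw set11.
by rewrite !inE => /andP[_ ->].
Qed.

(* If the vertex [- \sum_(v in A) v] completing [A] to an edge already lies in
   [A], then in characteristic 3 it is the sum of the other elements of [A], so
   [A] is determined by one of its (r-2)-subsets. *)
Lemma bin_le_shadow_zero_sum :
  (forall x : G, x *+ 3 = 0) -> (1 < r)%N ->
  ('C(#|G|, r.-1) <=
    #|shadow (zero_sum (subxx zero_sum_edges))| + 'C(#|G|, r - 2))%N.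
Proof.
move=> G3 r1; set S := shadow _.
have draws j : #|[set A : {set V} | #|A| == j]| = 'C(#|G|, j).
  by rewrite card_draws card_ord.
rewrite -!draws.
pose ext (B : {set V}) : {set V} := enum_rank (\sum_(v in B) (enum_val v : G)) |: B.
apply: (@leq_trans #|S :|: ext @: [set B : {set V} | #|B| == (r - 2)%N]|); last first.
  apply: leq_trans (leq_card_setU _ _) _.
  by rewrite leq_add2l leq_imset_card.
apply/subset_leq_card/fintype.subsetP => A; rewrite inE => /eqP Ar.
pose x : G := - \sum_(v in A) enum_val v.
rewrite inE; case: (boolP (enum_rank x \in A)) => xA.
  apply/orP; right; apply/imsetP; exists (A :\ enum_rank x).
    rewrite inE; have := cardsD1 (enum_rank x) A; rewrite xA Ar.
    by set d := #|_ :\ _|; clearbody d; lia.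
  rewrite /ext; set B := A :\ _.
  have -> : \sum_(v in B) (enum_val v : G) = x.
    have : x = - (x + \sum_(v in B) enum_val v).
      by rewrite {1}/x (big_setD1 _ xA) /= enum_rankK.
    move=> /eqP; rewrite -addr_eq0 addrA -(G3 x) mulrS mulr2n addrA => /eqP.
    exact: addrI.
  by rewrite finset.setD1K.
apply/orP; left; rewrite inE Ar eqxx/=; apply/existsP; exists (enum_rank x |: A).
rewrite finset.subsetUr andbT inE cardsU1 xA Ar big_setU1//= enum_rankK.
by rewrite addrC subrr eqxx andbT; apply/eqP; lia.
Qed.

End zero_sum.

(** * AM-GM and a Maclaurin inequality *)

Section means.
Variable F : realFieldType.

(** AM-GM for k copies of m and one copy of t. *)
Lemma AGM_expS (k : nat) (m t : F) : 0 <= m -> 0 <= t ->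
  m ^+ k * t <= ((m *+ k + t) / k.+1%:R) ^+ k.+1.
Proof.
move=> m0 t0.
pose E (i : 'I_k.+1) := if i == ord0 then t else m.
have E0 i : 0 <= E i by rewrite /E; case: ifP.
have [+ _] := @leif_AGM F 'I_k.+1 predT E (fun i _ => E0 i).
rewrite card_ord !big_ord_recl /E /= big_const_ord iter_mulr_1 sumr_const card_ord.
by rewrite mulrC addrC.
Qed.

(* Induction on the number of variables: with [m] the mean of all variables but
   [x ord0], the left-hand side is at most [m ^+ k] times an affine expression
   in [m] and [x ord0], to which [AGM_expS] applies. *)
Lemma maclaurinS (k : nat) (x : 'I_k.+1 -> F) : (forall i, 0 <= x i) ->
  \sum_i \prod_(j | j != i) x j <= k.+1%:R * ((\sum_i x i) / k.+1%:R) ^+ k.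
Proof.
elim: k x => [|k IH] x x0.
  rewrite big_ord1 expr0 mulr1 big_pred0// => i.
  by rewrite ord1 eqxx.
rewrite big_ord_recl [\sum_i x i]big_ord_recl.
pose y i := x (lift ord0 i).
have y0 i : 0 <= y i by exact: x0.
set m := (\sum_i y i) / k.+1%:R.
have m0 : 0 <= m by rewrite divr_ge0// sumr_ge0.
have -> : \sum_(i < k.+1) x (lift ord0 i) = m *+ k.+1.
  by rewrite -mulr_natr /m divfK// pnatr_eq0.
have -> : \prod_(j | j != ord0) x j = \prod_i y i.
  by rewrite big_mkcond big_ord_recl /= mul1r.
have -> : \sum_(i < k.+1) \prod_(j | j != lift ord0 i) x j =
    x ord0 * \sum_i \prod_(j | j != i) y j.
  rewrite mulr_sumr; apply: eq_bigr => i _.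
  rewrite big_mkcond big_ord_recl /=; congr (_ * _).
  rewrite [RHS]big_mkcond; apply: eq_bigr => j _.
  by rewrite (inj_eq lift_inj).
have pm : \prod_i y i <= m ^+ k.+1.
  have [+ _] := @leif_AGM F 'I_k.+1 predT y (fun i _ => y0 i).
  by rewrite card_ord.
have sm := IH y y0; rewrite -/m in sm.
apply: (le_trans (lerD pm (ler_wpM2l (x0 ord0) sm))).
have k2 : k.+2%:R != 0 :> F by rewrite pnatr_eq0.
have k1 : k.+1%:R != 0 :> F by rewrite pnatr_eq0.
(* This t makes the bound equal to (k+2) m^k t, and the mean of k copies of m and one t is then
   exactly the mean of all k+2 variables. *)
set t := (x ord0 * k.+1%:R + m) / k.+2%:R.
have t0 : 0 <= t by rewrite divr_ge0// addr_ge0// mulr_ge0.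
have -> : m ^+ k.+1 + x ord0 * (k.+1%:R * m ^+ k) = k.+2%:R * (m ^+ k * t).
  by rewrite /t exprS; field.
rewrite ler_pM2l ?ltr0n//.
apply: (le_trans (AGM_expS k m0 t0)).
rewrite le_eqVlt; apply/orP; left; apply/eqP; congr (_ ^+ _).
have e2 : k.+2%:R = k%:R + 2 :> F by rewrite -addn2 natrD.
have e1 : k.+1%:R = k%:R + 1 :> F by rewrite natr1.
rewrite /t -[m *+ k]mulr_natr -[m *+ k.+1]mulr_natr.
move: k1 k2; rewrite e1 e2 => k1 k2.
by field; rewrite k1 k2.
Qed.

Lemma maclaurin (n : nat) (x : 'I_n -> F) : (0 < n)%N -> (forall i, 0 <= x i) ->
  \sum_i \prod_(j | j != i) x j <= n%:R * ((\sum_i x i) / n%:R) ^+ n.-1.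
Proof. by case: n x => // k x _; exact: maclaurinS. Qed.

End means.

(** * Asymptotics of binomial coefficients *)

Section limits.
Variable R : realType.

Lemma cvg_natV : (n%:R^-1 @[n --> \oo] --> (0 : R))%classic.
Proof. by rewrite -cvg_shiftS; exact: cvg_harmonic. Qed.

(** By induction: (k+1) C(n,k+1) = (n-k) C(n,k), so passing from k to k+1 multiplies the quotient by
    (1 - k/n)/(k+1). *)
Lemma cvg_bin_expn k :
  (('C(n, k)%:R / n%:R ^+ k : R) @[n --> \oo] --> (k`!%:R^-1 : R))%classic.
Proof.
elim: k => [|k IH].
  under eq_fun do rewrite bin0 expr0 divr1.
  by rewrite fact0 invr1; exact: cvg_cst.
have h : ((1 - k%:R * n%:R^-1 : R) @[n --> \oo] --> (1 - k%:R * 0 : R))%classic.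
  apply: cvgB; first exact: cvg_cst.
  apply: cvgM; first exact: cvg_cst.
  exact: cvg_natV.
rewrite mulr0 subr0 in h.
have -> : (k.+1)`!%:R^-1 = k`!%:R^-1 * 1 * k.+1%:R^-1 :> R.
  by rewrite mulr1 factS natrM invfM mulrC.
apply: (cvg_trans _ (cvgM (cvgM IH h) (cvg_cst _))).
apply: near_eq_cvg; near=> n.
have nk : (k < n)%N by near: n; exact: nbhs_infty_gt.
rewrite /=.
have : k.+1%:R * 'C(n, k.+1)%:R = (n%:R - k%:R) * 'C(n, k)%:R :> R.
  by rewrite -natrB ?(ltnW nk)// -!natrM mul_bin_left.
move=> e.
have -> : 'C(n, k.+1)%:R = (n%:R - k%:R) * 'C(n, k)%:R / k.+1%:R :> R.
  by rewrite -e mulrC mulKf.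
have n0 : n%:R != 0 :> R by rewrite pnatr_eq0 -lt0n (leq_ltn_trans _ nk).
by rewrite exprS; field; rewrite n0 expf_neq0//= -natr1 ?natr1 pnatr_eq0.
Unshelve. all: by end_near. Qed.

Lemma cvg_expn_bin (r k : nat) :
  (((n%:R / r%:R) ^+ k / 'C(n, k)%:R : R) @[n --> \oo] -->
    (k`!%:R / r%:R ^+ k : R))%classic.
Proof.
have k0 : k`!%:R^-1 != 0 :> R by rewrite invr_neq0// pnatr_eq0 -lt0n fact_gt0.
rewrite -[k`!%:R]invrK.
apply: (cvg_trans _ (cvgM (cvgV k0 (@cvg_bin_expn k)) (cvg_cst (r%:R ^- k : R)))).
apply: near_eq_cvg; near=> n => /=.
by rewrite invf_div expr_div_n mulrAC.
Unshelve. all: by end_near. Qed.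

(** For n > k the quotient is C(n,k)/n^k times n^(k+1)/C(n,k+1) times 1/n; the first two factors
    have finite limits. *)
Lemma cvg_bin_ratio k :
  (('C(n, k)%:R / 'C(n, k.+1)%:R : R) @[n --> \oo] --> (0 : R))%classic.
Proof.
have k0 : (k.+1)`!%:R^-1 != 0 :> R by rewrite invr_neq0// pnatr_eq0 -lt0n fact_gt0.
have <- : k`!%:R^-1 * (k.+1)`!%:R^-1^-1 * 0 = 0 :> R by rewrite mulr0.
apply: (cvg_trans _
  (cvgM (cvgM (@cvg_bin_expn k) (cvgV k0 (@cvg_bin_expn k.+1))) cvg_natV)).
apply: near_eq_cvg; near=> n => /=.
have nk : (k < n)%N by near: n; exact: nbhs_infty_gt.
have n0 : n%:R != 0 :> R by rewrite pnatr_eq0 -lt0n (leq_ltn_trans _ nk).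
have c0 : 'C(n, k.+1)%:R != 0 :> R by rewrite pnatr_eq0 -lt0n bin_gt0.
by rewrite exprS; field; rewrite n0 c0 expf_neq0.
Unshelve. all: by end_near. Qed.

End limits.

(** * Density bounds at a fixed number of vertices *)

Section density_bounds.
Variables (R : realType) (r : nat) (H : hypergraph r).
Hypothesis r0 : (0 < r)%N.
Local Notation n := (order_of H).

Let sum_fibers (c : 'I_n -> 'I_r) :
  \sum_i #|[set x | c x == i]|%:R = n%:R :> R.
Proof. by rewrite -natr_sum sum_card_fibers card_ord. Qed.

Lemma colorable_card_edges : colorable H ->
  #|edges H|%:R <= (n%:R / r%:R) ^+ r :> R.
Proof.
move=> [c cP]; have := card_edges_colorable cP; rewrite -(ler_nat R) => /le_trans; apply.
have [+ _] := @leif_AGM R 'I_r predT (fun i => #|[set x | c x == i]|%:R)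
  (fun i _ => ler0n _ _).
by rewrite card_ord sum_fibers natr_prod.
Qed.

Lemma colorable_card_shadow : colorable H ->
  #|shadow H|%:R <= r%:R * (n%:R / r%:R) ^+ r.-1 :> R.
Proof.
move=> [c cP]; have := card_shadow_colorable r0 cP.
rewrite -(ler_nat R) => /le_trans; apply.
rewrite natr_sum; under eq_bigr do rewrite natr_prod.
by rewrite -(sum_fibers c); exact: maclaurin.
Qed.

Lemma colorable_density : colorable H ->
  density R H <= (n%:R / r%:R) ^+ r / 'C(n, r)%:R.
Proof. by move=> Hc; rewrite ler_wpM2r ?invr_ge0// colorable_card_edges. Qed.

Lemma colorable_shadow_density : colorable H ->
  shadow_density R H <= r%:R * ((n%:R / r%:R) ^+ r.-1 / 'C(n, r.-1)%:R).
Proof.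
by move=> Hc; rewrite mulrA ler_wpM2r ?invr_ge0// colorable_card_shadow.
Qed.

(** Here r times the number of edges is the size of the shadow, which is at most C(n,r-1). *)
Lemma partial_steiner_density : partial_steiner H ->
  density R H <= 'C(n, r.-1)%:R / 'C(n, r)%:R.
Proof.
move=> HS; rewrite ler_wpM2r ?invr_ge0// ler_nat.
apply: leq_trans (card_shadow_bin H).
by rewrite -(card_edges_partial_steiner r0 HS) leq_pmull.
Qed.

End density_bounds.

Lemma complete_partite_colorable r m : colorable (complete_partite r m).
Proof. by exists (@part_of r m) => e; exact: part_of_inj. Qed.

Section complete_partite_density.
Variables (R : realType) (r m : nat).
Hypothesis r0 : (0 < r)%N.
Let H := complete_partite r m.

Let part_size : (order_of H)%:R / r%:R = m%:R :> R.
Proof. by rewrite order_complete_partite natrM mulrC mulKf// pnatr_eq0 -lt0n. Qed.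

Lemma complete_partite_density :
  density R H = ((order_of H)%:R / r%:R) ^+ r / 'C(order_of H, r)%:R.
Proof.
congr (_ / _); apply/le_anti/andP; split.
  exact/colorable_card_edges/complete_partite_colorable.
by rewrite part_size -natrX ler_nat; exact: card_complete_partite_edges.
Qed.

Lemma complete_partite_shadow_density : (0 < m)%N ->
  shadow_density R H =
    r%:R * (((order_of H)%:R / r%:R) ^+ r.-1 / 'C(order_of H, r.-1)%:R).
Proof.
move=> m0; rewrite mulrA; congr (_ / _); apply/le_anti/andP; split.
  exact/colorable_card_shadow/complete_partite_colorable.
rewrite part_size -natrX -natrM ler_nat.
(* After multiplication by m > 0 the claim reads r m^r <= m |shadow|. It follows from having at
   least m^r edges and codegrees at most m. *)
rewrite -(leq_pmul2l m0) mulnCA -expnS prednK//.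
have := @card_edges_le_codegree r H m r0.
move=> /(_ (fun A => @codegree_complete_partite r m A r0)).
by apply: leq_trans; rewrite leq_mul2l card_complete_partite_edges orbT.
Qed.

End complete_partite_density.

Local Open Scope classical_set_scope.
Local Open Scope ring_scope.

(** * The feasible region of the forbidden family *)

Section region.
Variables (R : realType) (r : nat).
Hypothesis r1 : (1 < r)%N.

Let r0 : (0 < r)%N := ltnW r1.

Definition colorable_or_steiner : set (hypergraph r) :=
  [set H | colorable H \/ partial_steiner H].

Lemma is_free_colorable_or_steiner H :
  is_free (~` colorable_or_steiner) H <-> colorable_or_steiner H.
Proof.
apply: is_free_setC => {}H F HF [HP|HP]; [left|right].
- exact: colorable_contains HF HP.
- exact: partial_steiner_contains HF HP.
Qed.

Local Notation Om := (Omega (~` colorable_or_steiner) : set (R * R)).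

Let shadow_density_lim : R := (r.-1)`!%:R / r%:R ^+ (r - 2).
Let density_lim : R := r`!%:R / r%:R ^+ r.

Lemma cvg_shadow_density_bound :
  r%:R * ((n%:R / r%:R) ^+ r.-1 / 'C(n, r.-1)%:R) @[n --> \oo] --> shadow_density_lim.
Proof.
have -> : shadow_density_lim = r%:R * ((r.-1)`!%:R / r%:R ^+ r.-1).
  have rR : r%:R != 0 :> R by rewrite pnatr_eq0 -lt0n.
  rewrite /shadow_density_lim; have -> : r.-1 = (r - 2).+1 by move: r1; lia.
  by rewrite exprS; field; rewrite rR expf_neq0.
by apply: cvgM; [exact: cvg_cst|exact: cvg_expn_bin].
Qed.

Lemma cvg_steiner_bound : 'C(n, r.-1)%:R / 'C(n, r)%:R @[n --> \oo] --> (0 : R).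
Proof. by have := @cvg_bin_ratio R r.-1; rewrite prednK. Qed.

(** Adding the bounds of the two cases gives one majorant for a sequence that may alternate between
    r-partite r-graphs and partial Steiner systems; the Steiner term vanishes in the limit. *)
Lemma cvg_density_bound :
  (n%:R / r%:R) ^+ r / 'C(n, r)%:R + 'C(n, r.-1)%:R / 'C(n, r)%:R @[n --> \oo] -->
    density_lim.
Proof.
by rewrite -[density_lim]addr0; apply: cvgD;
  [exact: cvg_expn_bin|exact: cvg_steiner_bound].
Qed.

Lemma cvg_order (H : nat -> hypergraph r) (u : nat -> R) (l : R) :
  (fun k => order_of (H k)) @ \oo --> \oo -> u n @[n --> \oo] --> l ->
  u (order_of (H k)) @[k --> \oo] --> l.
Proof. exact: cvg_comp. Qed.

Lemma Omega_density_le x y : Om (x, y) -> y <= density_lim.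
Proof.
move=> [_ _ [H [[Hv _ _] Hfree [/= _ Hy]]]].
have Hb := cvg_order Hv cvg_density_bound.
apply: (ler_cvg_to Hy Hb); apply: nearW => k /=.
have [HP|HP] := (is_free_colorable_or_steiner _).1 (Hfree k).
  by apply: ler_wpDr; [rewrite divr_ge0|exact: colorable_density].
by apply: ler_wpDl;
  [rewrite divr_ge0// exprn_ge0// divr_ge0|exact: partial_steiner_density].
Qed.

Lemma Omega_density_le0 x y : Om (x, y) -> shadow_density_lim < x -> y <= 0.
Proof.
move=> [_ _ [H [[Hv _ _] Hfree [/= Hx Hy]]]] xlt.
have Hb := cvg_order Hv cvg_shadow_density_bound.
have Hc := cvg_order Hv cvg_steiner_bound.
(* The midpoint eventually separates the r-partite shadow bound from the actual shadow density, so
   from then on only partial Steiner systems can occur. *)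
have [xm mx] := midf_lt xlt.
apply: (ler_cvg_to Hy Hc); near=> k => /=.
have [HP|HP] := (is_free_colorable_or_steiner _).1 (Hfree k); last first.
  exact: partial_steiner_density.
have := colorable_shadow_density R r0 HP; rewrite leNgt => /negP[].
apply: (@lt_trans _ _ ((shadow_density_lim + x) / 2)).
  by near: k; exact: cvgr_lt Hb _ xm.
by near: k; exact: cvgr_gt Hx _ mx.
Unshelve. all: by end_near. Qed.

Lemma Omega_intro (H : nat -> hypergraph r) x y :
  (fun k => order_of (H k)) @ \oo --> \oo ->
  (forall k, colorable_or_steiner (H k)) -> realizes H x y -> Om (x, y).
Proof.
move=> Hv HC [Hx Hy].
have quotient_le1 (a b : nat) : (a <= b)%N -> a%:R / b%:R <= 1 :> R.
  (* With fewer than r vertices the binomial denominator may be 0; the quotient is then 0 by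
     convention. *)
  have [->|b0 ab] := posnP b; first by rewrite invr0 mulr0.
  by rewrite ler_pdivrMr ?ltr0n// mul1r ler_nat.
split=> /=.
- apply/andP; split.
    by apply: (cvgr_to_ge Hx); apply: nearW => k; rewrite divr_ge0.
  apply: (cvgr_to_le Hx); apply: nearW => k.
  exact/quotient_le1/card_shadow_bin.
- apply/andP; split.
    by apply: (cvgr_to_ge Hy); apply: nearW => k; rewrite divr_ge0.
  apply: (cvgr_to_le Hy); apply: nearW => k.
  exact/quotient_le1/card_edges_bin.
exists H; split=> //.
  by split=> //; apply/cvg_ex; [exists x|exists y].
by move=> k; apply/is_free_colorable_or_steiner.
Qed.

Lemma Omega_complete_partite : Om (shadow_density_lim, density_lim).
Proof.
pose H k := complete_partite r k.+1.
have Hv : (fun k => order_of (H k)) @ \oo --> \oo.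
  apply/cvgnyPge => A; near=> k; rewrite order_complete_partite.
  apply: (@leq_trans k.+1); last by rewrite leq_pmull.
  by apply: leqW; near: k; exact: (nbhs_infty_ge A).
apply: (Omega_intro Hv).
  by move=> k; left; exact: complete_partite_colorable.
split.
  apply: (cvg_trans _ (cvg_order Hv cvg_shadow_density_bound)).
  apply: near_eq_cvg; apply: nearW => k /=.
  by rewrite complete_partite_shadow_density.
apply: (cvg_trans _ (cvg_order Hv (@cvg_expn_bin R r r))).
apply: near_eq_cvg; apply: nearW => k /=.
by rewrite complete_partite_density.
Unshelve. all: by end_near. Qed.

Lemma Omega_zero_sum x : 0 <= x <= 1 -> Om (x, 0).
Proof.
move=> /andP[x0 x1].
pose G k : finZmodType := 'rV['F_3]_k.
have G3 k (v : G k) : v *+ 3 = 0.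
  by rewrite -scaler_nat (pchar_Fp_0 (isT : prime 3)) scale0r.
have cardG k : #|G k| = (3 ^ k)%N by rewrite card_mx card_Fp// mul1n.
pose full k := zero_sum (subxx (zero_sum_edges r (G k))).
(* Keeping [t k] of the edges approximates the fraction x with an error below one edge, that is,
   below r shadow sets. *)
pose t k := Num.trunc (x * #|edges (full k)|%:R).
have tP k : (t k)%:R <= x * #|edges (full k)|%:R < (t k).+1%:R.
  by rewrite truncn_itv// mulr_ge0.
have tE k : (t k <= #|zero_sum_edges r (G k)|)%N.
  have /andP[+ _] := tP k; rewrite -(ler_nat R) => /le_trans; apply.
  by rewrite ler_piMl.
have exF k : exists F : {set {set 'I_#|G k|}},
    F \subset zero_sum_edges r (G k) /\ #|F| = t k.
  by have [F] := eq_card_draw (tE k); exists F.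
have FP k := svalP (cid (exF k)).
pose H k := zero_sum (FP k).1.
have HS k : partial_steiner (H k) by exact: zero_sum_partial_steiner.
have Hv : (fun k => order_of (H k)) @ \oo --> \oo.
  apply/cvgnyPge => A; near=> k; rewrite /= cardG.
  apply: (@leq_trans k); last exact/ltnW/ltn_expl.
  by near: k; exact: (nbhs_infty_ge A).
apply: (Omega_intro Hv); first by move=> k; right.
split; last first.
  apply: (squeeze_cvgr _ (cvg_cst 0) (cvg_order Hv cvg_steiner_bound)).
  apply: nearW => k /=; rewrite partial_steiner_density// andbT.
  by rewrite divr_ge0.
have Hq := cvg_order Hv (@cvg_bin_ratio R (r - 2)).
have r21 : (r - 2).+1 = r.-1 by move: r1; lia.
(* Write C = C(n,r-1) and D = C(n,r-2). At most D sets are missing from the full shadow, which costs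
   x D, and rounding costs at most r <= r D. The total loss is at most (x + r) D, and D/C tends to
   0. *)
have Hl : x - (x + r%:R) * ('C(order_of (H k), r - 2)%:R /
    'C(order_of (H k), (r - 2).+1)%:R) @[k --> \oo] --> x.
  rewrite -[X in _ --> X]subr0 -[X in _ - X](mulr0 (x + r%:R)).
  by apply: cvgB; [exact: cvg_cst|apply: cvgM; [exact: cvg_cst|exact: Hq]].
apply: (squeeze_cvgr _ Hl (cvg_cst x)).
near=> k => /=.
have nk : (r <= #|G k|)%N.
  by near: k; move/cvgnyPge : Hv => /(_ r).
have shadowE : #|shadow (H k)| = (r * t k)%N.
  by rewrite -(card_edges_partial_steiner r0 (HS k)) /= (FP k).2.
have fullE := card_edges_partial_steiner r0
  (zero_sum_partial_steiner (FE := subxx (zero_sum_edges r (G k))) r0).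
have full_le := card_shadow_bin (full k).
have full_ge := bin_le_shadow_zero_sum (G3 k) r1.
rewrite -fullE -/(full k) in full_le full_ge.
rewrite r21 /shadow_density shadowE /=.
have c0 : 0 < 'C(#|G k|, r.-1)%:R :> R.
  by rewrite ltr0n bin_gt0 (leq_trans _ nk)// leq_pred.
have d1 : 1 <= 'C(#|G k|, r - 2)%:R :> R.
  by rewrite ler1n bin_gt0 (leq_trans _ nk)// leq_subr.
move: full_le full_ge (tP k); rewrite -!(ler_nat R) -natr1 natrD !natrM /=.
set E := #|edges (full k)|%:R; set C := 'C(_, r.-1)%:R; set D := 'C(_, r - 2)%:R.
move=> full_le full_ge /andP[t_le t_ge].
have xE_ge : x * (C - D) <= x * (r%:R * E) by rewrite ler_wpM2l// lerBlDr.
have xE_le : x * (r%:R * E) <= x * C by rewrite ler_wpM2l.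
have rt_le : r%:R * (t k)%:R <= r%:R * (x * E) by rewrite ler_wpM2l.
have rt_ge : r%:R * (x * E) <= r%:R * ((t k)%:R + 1).
  by rewrite ler_wpM2l// ltW.
have rD : r%:R <= r%:R * D by rewrite ler_peMr.
apply/andP; split; last by rewrite ler_pdivrMr//; lra.
rewrite ler_pdivlMr// mulrBl -!mulrA mulVf ?gt_eqF// mulr1.
by lra.
Unshelve. all: by end_near. Qed.

End region.

Theorem theorem8p1 (R : realType) (r : nat) (hr : (3 <= r)%N) :
  exists D : set (hypergraph r),
    [/\ projOmega D = `[0, 1]%classic :> set R,
        g D ((r.-1)`!%:R / r%:R ^+ (r - 2) : R) = r`!%:R / r%:R ^+ r &
        exists2 delta0 : R, 0 < delta0 &
          forall eps : R,
            0 < eps -> eps <= 1 - (r.-1)`!%:R / r%:R ^+ (r - 2) ->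
            g D ((r.-1)`!%:R / r%:R ^+ (r - 2) + eps)
              < r`!%:R / r%:R ^+ r - delta0].
Proof.
have r1 : (1 < r)%N by exact: ltnW.
have r0 : (0 < r)%N by exact: ltnW.
have proj : projOmega (~` @colorable_or_steiner r) = `[0, 1]%classic :> set R.
  apply/seteqP; split=> x /=; rewrite in_itv /=; first by move=> [y []].
  by move=> x01; exists 0; exact: Omega_zero_sum.
have dpos : 0 < r`!%:R / r%:R ^+ r :> R.
  by rewrite divr_gt0 ?exprn_gt0 ?ltr0n ?fact_gt0.
have Ox := Omega_complete_partite R r1.
exists (~` @colorable_or_steiner r); split=> //.
  have [Og gmax] := gP (ex_intro (fun y => Omega _ (_, y)) _ Ox).
  by apply/le_anti; rewrite (Omega_density_le r1 Og) gmax.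
(* Beyond the critical shadow density g is at most 0, so half of the maximal density is a sufficient
   gap. *)
exists (r`!%:R / r%:R ^+ r / 2); first by rewrite divr_gt0.
move=> eps e0 e1; set x := _ + eps.
(* The upper bound on [eps] keeps x in [0,1], so [g] is an attained maximum here and not its default
   value. *)
have /gP[Og _] : projOmega (~` @colorable_or_steiner r) x.
  rewrite proj /= in_itv /= -lerBrDl e1 andbT.
  by rewrite addr_ge0 ?(ltW e0)// divr_ge0.
have := Omega_density_le0 r1 Og; rewrite ltrDl => /(_ e0) /le_lt_trans; apply.
lra.
Qed.
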